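(* Let $n\ge3$ and let $\langle G\mid\mu_n\rangle$ be an $n$-ary group. Then there exists a binary group $\langle G\mid\ast,e\rangle$ on the same set $G$, with identity $e$, such that the following invariance holds. For $q=0$ put $$\mathcal{M}_0(g_1,\ldots,g_n)=\mu_n[g_1,\ldots,g_n],$$ and for every admissible $q>0$ put $$\mathcal{M}_q(g_1,\ldots,g_n)=g_1\ast\varphi_q^{[[1]]_q}(g_2)\ast\varphi_q^{[[2]]_q}(g_3)\ast\cdots\ast\varphi_q^{[[n-1]]_q}(g_n)\ast b_q,$$ where $$\varphi_q(g)=\boldsymbol{\mu}_n^{\ell_\varphi(q)}\bigl[e,g,(\mathbf{e}^{-1})^q\bigr],\qquad b_q=\boldsymbol{\mu}_n^{\ell_e(q)}\bigl[e^{[[n]]_q}\bigr],$$ and $\varphi_q$ is a quasi-endomorphism of $\langle G\mid\ast,e\rangle$. Then for all $g_1,\dots,g_n\in G$ the value $\mathcal{M}_q(g_1,\ldots,g_n)$ is the same for $q=0$ and for all admissible $q>0$.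
   Context: $G$ is a non-empty set. An $n$-ary group $\langle G\mid\mu_n\rangle$ is $G$ with an operation $\mu_n:G^n\to G$ that is totally associative (in the composition of two copies of $\mu_n$ applied to $2n-1$ elements in a fixed order, the inner $\mu_n$ may be placed at any position without changing the value) and such that for every place $i=1,\dots,n$, the equation $\mu_n[u_1,\dots,u_{i-1},h,t_{i+1},\dots,t_n]=g$ has a unique solution $h\in G$ for any given $u_j,t_j,g\in G$. In polyads, $g^m$ denotes $m$ consecutive copies of $g$, and similarly $(\mathbf{t})^m$ is $m$ consecutive copies of a polyad (finite sequence) $\mathbf{t}$. The iterated product $\boldsymbol{\mu}_n^{\ell}$ is the $\ell$-fold composition of $\mu_n$ with itself, an operation on $\ell(n-1)+1$ arguments (well defined by associativity). A polyadic inverse of $e\in G$ is a polyad $\mathbf{e}^{-1}\in G^{n-2}$ such that $\mu_n[e,\mathbf{e}^{-1},h]=\mu_n[\mathbf{e}^{-1},e,h]=\mu_n[h,e,\mathbf{e}^{-1}]=\mu_n[h,\mathbf{e}^{-1},e]=h$ for all $h\in G$. In an $n$-ary group one exists for every $e$, e.g. $\mathbf{e}^{-1}=(e^{n-3},\bar e)$, where $\bar e$ is the unique solution of $\mu_n[e^{n-1},\bar e]=e$; fix one. The $q$-deformed number is $[[k]]_q=\frac{q^k-1}{q-1}=1+q+\dots+q^{k-1}$ (so $[[k]]_1=k$ and $[[0]]_q=0$). A positive integer $q$ is called admissible (for $n$) if $$\ell_\varphi(q)=\frac{q(n-2)+1}{n-1}\quad\text{and}\quad \ell_e(q)=q\,\frac{[[n-1]]_q}{n-1}$$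 are both integers; then the numbers of arguments in the formulas for $\varphi_q$ and $b_q$ match the arities of the iterated products. A map $\varphi:G\to G$ is a quasi-endomorphism of a binary group $\langle G\mid\ast,e\rangle$ if $\varphi(g)\ast\varphi(h)=\varphi(g\ast\varphi(e)\ast h)$ for all $g,h\in G$. $\varphi_q^k$ is the $k$-fold composition of $\varphi_q$, with $\varphi_q^0=\mathrm{id}$. *)

(* Defs.v *)
From mathcomp Require Import all_boot.
From mathcomp Require Import zify.

Set Implicit Arguments.
Unset Strict Implicit.
Unset Printing Implicit Defensive.

(* Polyads are sequences.  An n-ary operation takes an [n.-tuple G], so a      *)
(* polyad may be passed to it only together with a proof that it has the right *)
(* length; this is the role of the [size_*] lemmas below.                      *)

Definition nary_op (n : nat) (G : Type) := n.-tuple G -> G.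

Lemma size_inner (n : nat) (G : Type) (i : 'I_n)
  (t : (n.-1 + n).-tuple G) : size (take n (drop i t)) == n.
Proof.
by rewrite size_take size_drop size_tuple; case: ltnP; have := ltn_ord i; lia.
Qed.

Lemma size_outer (n : nat) (G : Type) (i : 'I_n)
  (t : (n.-1 + n).-tuple G) (x : G) :
  size (take i t ++ x :: drop (i + n) t) == n.
Proof.
rewrite size_cat /= size_take size_drop size_tuple.
by case: ltnP; have := ltn_ord i; lia.
Qed.

Definition compose_at (n : nat) (G : Type) (mu : nary_op n G) (i : 'I_n)
    (t : (n.-1 + n).-tuple G) : G :=
  mu (Tuple (size_outer i t (mu (Tuple (size_inner i t))))).

Definition totally_associative (n : nat) (G : Type) (mu : nary_op n G) : Prop :=
  forall (t : (n.-1 + n).-tuple G) (i j : 'I_n),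
    compose_at mu i t = compose_at mu j t.

(* The i-th entry of [t] is overwritten by the unknown [h], so only the other  *)
(* entries of [t] serve as data of the equation.                               *)
Definition uniquely_solvable (n : nat) (G : Type) (mu : nary_op n G) : Prop :=
  forall (i : 'I_n) (t : n.-tuple G) (g : G),
    exists! h, mu [tuple if j == i then h else tnth t j | j < n] = g.

Definition is_nary_group (n : nat) (G : Type) (mu : nary_op n G) : Prop :=
  totally_associative mu /\ uniquely_solvable mu.

Lemma size_iter_step (n : nat) (G : Type) (l : nat)
  (t : (l.+1 * n.-1).+1.-tuple G) : size (take n t) == n.
Proof.
by rewrite size_take size_tuple mulSn; move: (l * _) => k; case: ltnP; lia.
Qed.

Lemma size_iter_rest (n : nat) (G : Type) (l : nat)
  (t : (l.+1 * n.-1).+1.-tuple G) (x : G) :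
  size (x :: drop n.-1 (behead t)) == (l * n.-1).+1.
Proof. by rewrite /= size_drop size_behead size_tuple /= mulSn addKn. Qed.

(* The l-fold composition of mu, bracketed to the left; by total associativity *)
(* the bracketing is immaterial.  For 0 < n, [drop n.-1 (behead t)] is         *)
(* [drop n t].                                                                 *)
Fixpoint iter_op (n : nat) (G : Type) (mu : nary_op n G) (l : nat) :
    (l * n.-1).+1.-tuple G -> G :=
  match l with
  | 0 => fun t => thead t
  | l'.+1 => fun t =>
      iter_op mu (Tuple (size_iter_rest t (mu (Tuple (size_iter_step t)))))
  end.

Section PolyadicInverse.

Variables (n : nat) (n_ge3 : 3 <= n) (G : Type) (mu : nary_op n G).

Lemma size_inv_eph (e : G) (p : n.-2.-tuple G) (h : G) :
  size ([:: e] ++ p ++ [:: h]) == n.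
Proof. by rewrite !size_cat size_tuple /=; lia. Qed.

Lemma size_inv_peh (e : G) (p : n.-2.-tuple G) (h : G) :
  size (p ++ [:: e; h]) == n.
Proof. by rewrite size_cat size_tuple /=; lia. Qed.

Lemma size_inv_hep (e : G) (p : n.-2.-tuple G) (h : G) :
  size ([:: h; e] ++ p) == n.
Proof. by rewrite size_cat size_tuple /=; lia. Qed.

Lemma size_inv_hpe (e : G) (p : n.-2.-tuple G) (h : G) :
  size ([:: h] ++ p ++ [:: e]) == n.
Proof. by rewrite !size_cat size_tuple /=; lia. Qed.

Definition is_polyadic_inverse (e : G) (p : n.-2.-tuple G) : Prop :=
  forall h : G,
    [/\ mu (Tuple (size_inv_eph e p h)) = h,
        mu (Tuple (size_inv_peh e p h)) = h,
        mu (Tuple (size_inv_hep e p h)) = h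
      & mu (Tuple (size_inv_hpe e p h)) = h].

Lemma polyadic_inverse_exists (e : G) :
  is_nary_group mu -> exists p, is_polyadic_inverse e p.
Proof.
move=> [muA muS].
pose M (s : seq G) := mu [tuple nth e s i | i < n].
have ME s (hs : size s == n) : mu (Tuple hs) = M s.
  congr mu; apply: eq_from_tnth => i.
  by rewrite tnth_mktuple (tnth_nth e).
have MA (a b c a' b' c' : seq G) : size b = n -> size b' = n ->
    size (a ++ b ++ c) = n.-1 + n ->
    a ++ b ++ c = a' ++ b' ++ c' -> M (a ++ M b :: c) = M (a' ++ M b' :: c').
  move=> sb sb' ss E.
  have C (x y z : seq G) (st : size (x ++ y ++ z) == n.-1 + n) :
      size y = n -> forall hx : size x < n,
      compose_at mu (Ordinal hx) (Tuple st) = M (x ++ M y :: z).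
    move=> sy hx; rewrite /compose_at !ME /= take_size_cat //.
    rewrite drop_size_cat // take_size_cat //.
    by rewrite -sy -size_cat catA drop_size_cat.
  have st : size (a ++ b ++ c) == n.-1 + n by apply/eqP.
  have st' : size (a' ++ b' ++ c') == n.-1 + n by rewrite -E.
  have ha : size a < n by move: ss; rewrite !size_cat sb; lia.
  have ha' : size a' < n.
    by move/eqP: st'; rewrite !size_cat sb'; lia.
  rewrite -(C a b c st sb ha) -(C a' b' c' st' sb' ha').
  have -> : Tuple st = Tuple st' by apply: val_inj.
  exact: muA.
have n_gt0 : 0 < n by lia.
have ML s g : size s = n.-1 -> exists h, M (h :: s) = g.
  move=> sz; have hs : size (e :: s) == n by rewrite /= sz; lia.
  have [h [<- _]] := muS (Ordinal n_gt0) (Tuple hs) g.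
  exists h; congr mu; apply: eq_from_tnth => i.
  by rewrite !tnth_mktuple (tnth_nth e) -val_eqE /=; case: (val i).
have hn1 : n.-1 < n by lia.
have nth_last (s : seq G) x (i : 'I_n) : size s = n.-1 ->
    nth e (rcons s x) i = if i == Ordinal hn1 then x else nth e (rcons s e) i.
  move=> sz; rewrite !nth_rcons sz -val_eqE /=.
  by case: (ltngtP (nat_of_ord i) n.-1).
have MR s g : size s = n.-1 -> exists! h, M (rcons s h) = g.
  move=> sz; have hs : size (rcons s e) == n by rewrite size_rcons sz; lia.
  have E h : M (rcons s h) =
      mu [tuple if j == Ordinal hn1 then h else tnth (Tuple hs) j | j < n].
    congr mu; apply: eq_from_tnth => i.
    by rewrite !tnth_mktuple nth_last // (tnth_nth e).
  have [h [<- hU]] := muS (Ordinal hn1) (Tuple hs) g.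
  by exists h; split; [rewrite E | move=> h'; rewrite E; apply: hU].
pose E k := nseq k e.
have [b [bE _]] := MR (E n.-1) e (size_nseq _ _).
have ED i j : E i ++ E j = E (i + j) by rewrite /E nseqD.
have E1 i : e :: E i = E i.+1 by [].
have Er i s : E i ++ e :: s = E i.+1 ++ s.
  by rewrite -cat1s catA -[[:: e]]/(E 1) ED addn1.
have sp : size (E (n - 3) ++ [:: b]) == n.-2.
  by rewrite size_cat size_nseq /=; lia.
rewrite -cats1 in bE.
have eqE i j s t : i = j -> s = t -> E i ++ s = E j ++ t by move=> -> ->.
have R h : M (h :: E n.-2 ++ [:: b]) = h.
  have [x xE] := ML (E n.-1) h (size_nseq _ _).
  have := MA [::] (x :: E n.-1) (E n.-2 ++ [:: b])
    (x :: E n.-2) (E n.-1 ++ [:: b]) [::].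
  rewrite /= xE bE Er !cats0 prednK; last by lia.
  rewrite xE; apply; rewrite /E ?(size_cat, size_nseq) /= ?size_nseq; try lia.
  by rewrite !catA !ED addnC.
have bL : M (b :: E n.-1) = e.
  have [f [_ fU]] := MR (E n.-1) (M (E n)) (size_nseq _ _).
  rewrite -(fU e) ?(fU (M (b :: E n.-1))) // -cats1.
    have := MA (E n.-1) (b :: E n.-1) [::] [::] (E n.-1 ++ [:: b]) (E n.-1).
    rewrite /= bE cats0 E1 prednK; last by lia.
    apply; rewrite /E ?(size_cat, size_nseq) /= ?size_nseq; try lia.
    by rewrite -catA.
  by rewrite Er cats0 prednK //; lia.
have Rx h : exists y, M (E n.-1 ++ [:: y]) = h.
  by have [y [yE _]] := MR (E n.-1) h (size_nseq _ _); exists y; rewrite cats1.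
exists (Tuple sp) => h; rewrite !ME /= -?catA /=; split.
- have [y yE] := Rx h.
  have := MA (E n.-2 ++ [:: b]) (E n.-1 ++ [:: y]) [::]
    (E n.-2) (b :: E n.-1) [:: y].
  rewrite bL yE Er prednK; last by lia.
  rewrite yE => H; apply: (etrans _ (H _ _ _ _)).
  + by rewrite -!catA; congr M; apply: (eqE (n - 3).+1); first by lia.
  + by rewrite /E ?(size_cat, size_nseq) /=; lia.
  + by rewrite /E /= size_nseq; lia.
  + by rewrite /E ?(size_cat, size_nseq) /=; lia.
  by rewrite -!catA.
- have [y yE] := Rx h.
  have := MA (E (n - 3) ++ [:: b; e]) (E n.-1 ++ [:: y]) [::]
    (E (n - 3)) (b :: E n.-1) [:: e; y].
  rewrite bL yE !Er.
  have -> : (n - 3).+2 = n.-1 by lia.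
  rewrite yE => H; apply: (etrans _ (H _ _ _ _)).
  + by rewrite -!catA.
  + by rewrite /E ?(size_cat, size_nseq) /=; lia.
  + by rewrite /E /= size_nseq; lia.
  + by rewrite /E ?(size_cat, size_nseq) /=; lia.
  by rewrite -!catA /= Er.
- rewrite -[RHS]R; congr (M (h :: _)).
  by rewrite -[LHS]/(E (n - 3).+1 ++ _); apply: eqE => //; lia.
- have [x xE] := ML (E n.-1) h (size_nseq _ _).
  have := MA [::] (x :: E n.-1) (E (n - 3) ++ [:: b; e])
    (x :: E (n - 3)) (E n.-1 ++ [:: b]) [:: e].
  rewrite /= xE bE !Er !cats0.
  have -> : (n - 3).+2 = n.-1 by lia.
  rewrite xE; apply; rewrite /E ?(size_cat, size_nseq) /=
    ?(size_cat, size_nseq) /=; try lia.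
  by rewrite -!catA /= !catA !ED addnC.
Qed.

End PolyadicInverse.

Definition is_group (G : Type) (star : G -> G -> G) (e : G) : Prop :=
  [/\ associative star, left_id e star, right_id e star
    & forall g, exists h, star h g = e /\ star g h = e].

Definition quasi_endomorphism (G : Type) (star : G -> G -> G) (e : G)
    (phi : G -> G) : Prop :=
  forall g h, star (phi g) (phi h) = phi (star (star g (phi e)) h).

Definition qnum (q k : nat) : nat := \sum_(i < k) q ^ i.

Definition admissible (n q : nat) : bool :=
  [&& 0 < q, n.-1 %| q * n.-2 + 1 & n.-1 %| q * qnum q n.-1].

Definition l_phi (n q : nat) : nat := (q * n.-2 + 1) %/ n.-1.

Definition l_e (n q : nat) : nat := (q * qnum q n.-1) %/ n.-1.

Lemma size_phi (n q : nat) (G : Type) (e : G) (p : n.-2.-tuple G) (g : G) :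
  admissible n q ->
  size ([:: e; g] ++ flatten (nseq q (tval p))) == (l_phi n q * n.-1).+1.
Proof.
case/and3P=> _ Hphi _; rewrite /l_phi divnK // size_cat size_flatten /shape.
by rewrite map_nseq sumn_nseq size_tuple /=; lia.
Qed.

Lemma size_b (n q : nat) (G : Type) (e : G) :
  3 <= n -> admissible n q ->
  size (nseq (qnum q n) e) == (l_e n q * n.-1).+1.
Proof.
move=> n_ge3 /and3P[_ _ He]; rewrite /l_e divnK // size_nseq /qnum.
case: n n_ge3 {He} => // n _; rewrite big_ord_recl expn0 add1n big_distrr /=.
by apply/eqP; congr _.+1; apply: eq_bigr => i _; rewrite -expnS.
Qed.

Definition phi_q (n : nat) (G : Type) (mu : nary_op n G) (e : G)
    (p : n.-2.-tuple G) (q : nat) (adm : admissible n q) (g : G) : G :=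
  iter_op mu (Tuple (size_phi e p g adm)).

Definition b_q (n : nat) (n_ge3 : 3 <= n) (G : Type) (mu : nary_op n G) (e : G)
    (q : nat) (adm : admissible n q) : G :=
  iter_op mu (Tuple (size_b e n_ge3 adm)).

(* With indices counted from 0, the i-th factor is phi_q^{[[i]]_q}(g_i); the   *)
(* factor at i = 0 is g_0 itself, as [[0]]_q = 0.                              *)
Definition M_q (n : nat) (n_ge3 : 3 <= n) (G : Type) (mu : nary_op n G)
    (star : G -> G -> G) (e : G) (p : n.-2.-tuple G)
    (q : nat) (adm : admissible n q) (g : n.-tuple G) : G :=
  star (\big[star/e]_(i < n) iter (qnum q i) (phi_q mu e p adm) (tnth g i))
       (b_q n_ge3 mu e adm).

(* Main.v *)
Require Import Defs.
From mathcomp Require Import all_boot.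
From mathcomp Require Import zify.

(** Words (polyads) are taken modulo the congruence that identifies two words
    when they give the same iterated product in every context.  This plays the
    role of Post's covering group: there the polyad [e^-1] is the inverse of
    [e], the binary product is [g * h = g e^-1 h], and [phi_q g = e g e^-q], so
    that [phi_q^k g = e^k g e^-qk].  Since [1 + q [[i]] = [[i+1]]], the
    [*]-product of the [phi_q^[[i-1]] g_i] telescopes to [g_1 ... g_n e^-[[n]] e],
    and [*]-multiplication by [b_q = e^[[n]]] cancels the powers of [e]. *)

Set Implicit Arguments.
Unset Strict Implicit.
Unset Printing Implicit Defensive.

(** * Iterated products of words and their independence of bracketing *)

Section PolyadCongruence.

Variables (n : nat) (n_ge3 : 3 <= n) (G : Type) (mu : nary_op n G).
Hypothesis muA : totally_associative mu.
(* Only fills the out-of-range positions of words of the wrong length. *)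
Variable x0 : G.

(** Taking a bare sequence instead of a tuple keeps length proofs out of the terms, so that words
    can be rewritten freely. *)
Definition mu_word (s : seq G) : G := mu [tuple nth x0 s i | i < n].

Lemma mu_wordE (s : seq G) (hs : size s == n) : mu (Tuple hs) = mu_word s.
Proof.
congr mu; apply: eq_from_tnth => i.
by rewrite tnth_mktuple (tnth_nth x0).
Qed.

Lemma compose_at_word (a s b : seq G) (st : size (a ++ s ++ b) == n.-1 + n)
    (ha : size a < n) :
  size s = n ->
  compose_at mu (Ordinal ha) (Tuple st) = mu_word (a ++ mu_word s :: b).
Proof.
move=> ss; rewrite /compose_at !mu_wordE /= take_size_cat // drop_size_cat //.
by rewrite take_size_cat // -ss -size_cat catA drop_size_cat.
Qed.

Lemma mu_wordA (a s b s' b' : seq G) :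
  size s = n -> size s' = n -> size (a ++ s ++ b) = n.-1 + n ->
  a ++ s ++ b = s' ++ b' ->
  mu_word (a ++ mu_word s :: b) = mu_word (mu_word s' :: b').
Proof.
move=> ss ss' sz E.
have st : size (a ++ s ++ b) == n.-1 + n by apply/eqP.
have st' : size ([::] ++ s' ++ b') == n.-1 + n by rewrite /= -E.
have ha : size a < n by move: sz; rewrite !size_cat ss; lia.
have h0 : @size G [::] < n by rewrite /=; lia.
rewrite -(compose_at_word st ha ss) -[mu_word s' :: b']/([::] ++ _).
rewrite -(compose_at_word st' h0 ss').
have -> : Tuple st = Tuple st' by apply: val_inj.
exact: muA.
Qed.

Fixpoint iter_word (l : nat) (s : seq G) : G :=
  if l is l'.+1 then iter_word l' (mu_word (take n s) :: drop n s)
  else head x0 s.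

Lemma iter_opE (l : nat) (t : (l * n.-1).+1.-tuple G) :
  iter_op mu t = iter_word l t.
Proof.
elim: l t => [|l IH] t /=; first by rewrite /thead (tnth_nth x0) nth0.
rewrite IH /= mu_wordE -drop1 drop_drop; congr (iter_word l (_ :: drop _ _)).
by lia.
Qed.

Lemma iter_word_cat (l : nat) (s b : seq G) :
  size s = n -> iter_word l.+1 (s ++ b) = iter_word l (mu_word s :: b).
Proof. by move=> ss /=; rewrite take_size_cat // drop_size_cat. Qed.

(** General associativity: [iter_word] multiplies from the left, and total associativity brings a
    product formed anywhere into that order. *)
Lemma iter_word_mu (l : nat) (a s b : seq G) :
  size s = n -> size (a ++ s ++ b) = (l.+1 * n.-1).+1 ->
  iter_word l.+1 (a ++ s ++ b) = iter_word l (a ++ mu_word s :: b).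
Proof.
move=> ss; elim: l a => [|l IH] a sz.
  have [/size0nil -> /size0nil ->] : size a = 0 /\ size b = 0.
    by move: sz; rewrite !size_cat; lia.
  exact: (iter_word_cat 0 [::] ss).
(* If [a] has at least [n] letters, the first multiplication happens inside [a] on both sides, and
   induction applies. *)
case: (leqP n (size a)) => ha.
  have s1 : size (take n a) = n by rewrite size_takel.
  rewrite -(cat_take_drop n a) -!catA !iter_word_cat //.
  rewrite -!cat_cons IH //.
  by move: sz; rewrite /= !size_cat size_drop; lia.
(* Otherwise [s] starts within the first [n] letters; [k] letters of [b] complete [a ++ s] to a word
   of length [2n-1], where [mu_wordA] moves the inner product to the front. *)
pose k := n.-1 - size a.
have sk : size (take k b) = k.
  rewrite size_takel //; move: sz; rewrite !size_cat ss !mulSn /k.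
  by move: (l * n.-1) => z; lia.
have sw : size (a ++ s ++ take k b) = n.-1 + n.
  by rewrite !size_cat sk ss /k; lia.
set w := a ++ s ++ take k b in sw.
have -> : a ++ s ++ b = take n w ++ drop n w ++ drop k b.
  by rewrite (catA (take n w)) cat_take_drop /w -!catA cat_take_drop.
have -> : a ++ mu_word s :: b = (a ++ mu_word s :: take k b) ++ drop k b.
  by rewrite -catA cat_cons cat_take_drop.
have stw : size (take n w) = n by rewrite size_takel // sw; lia.
rewrite iter_word_cat // -cat_cons iter_word_cat; last first.
  by rewrite /= size_drop sw; lia.
rewrite iter_word_cat; last by rewrite size_cat /= sk /k; lia.
by rewrite (mu_wordA ss stw sw (esym (cat_take_drop n w))).
Qed.

(** * The congruence of words *)

Definition word_val (s : seq G) : G := iter_word ((size s).-1 %/ n.-1) s.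

Lemma word_valE (l : nat) (s : seq G) :
  size s = (l * n.-1).+1 -> word_val s = iter_word l s.
Proof. by move=> sz; rewrite /word_val sz /= mulnK //; lia. Qed.

Lemma size_word_mod1 (s : seq G) :
  size s = 1 %[mod n.-1] -> exists l, size s = (l * n.-1).+1.
Proof.
rewrite (modn_small (_ : 1 < n.-1)); last by lia.
move=> E; exists (size s %/ n.-1).
by rewrite {1}(divn_eq (size s) n.-1) E addn1.
Qed.

(* The congruence on lengths makes the relation transitive: without it, an
   intermediate word could fit in no context that fits the outer two. *)
Definition eqv (s t : seq G) : Prop :=
  size s = size t %[mod n.-1] /\
  forall a b, size (a ++ s ++ b) = 1 %[mod n.-1] ->
    word_val (a ++ s ++ b) = word_val (a ++ t ++ b).

Lemma size_context (a b s t : seq G) :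
  size s = size t %[mod n.-1] ->
  size (a ++ s ++ b) = size (a ++ t ++ b) %[mod n.-1].
Proof.
move=> st; apply/eqP.
by rewrite !size_cat eqn_modDl eqn_modDr; apply/eqP.
Qed.

Lemma eqv_refl (s : seq G) : eqv s s.
Proof. by []. Qed.

Lemma eqv_sym (s t : seq G) : eqv s t -> eqv t s.
Proof.
move=> [sz H]; split=> // a b hs; rewrite H //.
by rewrite (size_context _ _ sz).
Qed.

Lemma eqv_trans (s t u : seq G) : eqv s t -> eqv t u -> eqv s u.
Proof.
move=> [sz1 H1] [sz2 H2]; split; first by rewrite sz1.
by move=> a b hs; rewrite H1 // H2 // -(size_context _ _ sz1).
Qed.

Lemma eqv_context (a b s t : seq G) :
  eqv s t -> eqv (a ++ s ++ b) (a ++ t ++ b).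
Proof.
move=> [sz H]; split; first exact: size_context.
move=> c d; have E u : c ++ (a ++ u ++ b) ++ d = (c ++ a) ++ u ++ b ++ d.
  by rewrite -!catA.
by rewrite !E; apply: H.
Qed.

Lemma eqv_cat (s t s' t' : seq G) :
  eqv s t -> eqv s' t' -> eqv (s ++ s') (t ++ t').
Proof.
move=> E E'; apply: (@eqv_trans _ (t ++ s')).
  exact: (eqv_context [::] s' E).
by have := eqv_context t [::] E'; rewrite !cats0.
Qed.

Lemma eqv_cancel (u a b : seq G) : eqv u [::] -> eqv (a ++ u ++ b) (a ++ b).
Proof. exact: eqv_context. Qed.

(** The empty context separates single letters, so identities in [G] can be proved as congruences of
    words. *)
Lemma eqv_inj (x y : G) : eqv [:: x] [:: y] -> x = y.
Proof. by case=> _ /(_ [::] [::] erefl); rewrite /word_val /= div0n. Qed.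

Lemma eqv_mu_word (s : seq G) : size s = n -> eqv [:: mu_word s] s.
Proof.
move=> ss; apply: eqv_sym; split.
  have nE : n = n.-1 + 1 by lia.
  by rewrite ss {1}nE modnDl.
move=> a b /size_word_mod1 [[|l] sz].
  by move: sz; rewrite !size_cat; lia.
rewrite (word_valE sz) iter_word_mu // (@word_valE l) //.
by move: sz; rewrite !size_cat /=; lia.
Qed.

Lemma eqv_iter_word (l : nat) (s : seq G) :
  size s = (l * n.-1).+1 -> eqv [:: iter_word l s] s.
Proof.
elim: l s => [|l IH] s sz; first by case: s sz => [|x []].
have sn : size (take n s) = n.
  by rewrite size_takel // sz mulSn; move: (l * _) => k; lia.
apply: (eqv_trans (IH _ _)).
  by rewrite /= size_drop sz mulSn; move: (l * _) => k; lia.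
have := eqv_cat (eqv_mu_word sn) (eqv_refl (drop n s)).
by rewrite cat_take_drop.
Qed.

(** In a nonempty context some letter is adjacent to [u] and absorbs it. The empty context does not
    arise: the length of [u] is 0 modulo [n-1], whereas a value requires length 1. *)
Lemma eqv_nil (u : seq G) :
  (forall h, eqv (u ++ [:: h]) [:: h]) -> (forall h, eqv (h :: u) [:: h]) ->
  eqv u [::].
Proof.
move=> ul ur; have su : size u = 0 %[mod n.-1].
  have [sz _] := ur x0; apply/eqP; rewrite -(eqn_modDl 1).
  by apply/eqP.
split=> // a [|h b] hs; last first.
  have [_ /(_ a b)] := ul h; rewrite -!catA; exact.
move: hs; rewrite !cats0; case/lastP: a => [|a h] hs.
  by move: hs; rewrite su mod0n modn_small //; lia.
rewrite -cats1 -catA; have [_ /(_ a [::])] := ur h.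
by rewrite !cats0; apply; rewrite -cat_rcons.
Qed.

(** * Cancellation of a polyadic inverse *)

Section PolyadicInverse.

Variables (e : G) (p : n.-2.-tuple G).
Hypothesis pP : is_polyadic_inverse n_ge3 mu e p.

Lemma eqv_inverse : eqv (e :: p) [::] /\ eqv (p ++ [:: e]) [::].
Proof.
(* The four equations defining a polyadic inverse are exactly the absorption hypotheses of [eqv_nil]
   for the two words. *)
split; apply: eqv_nil => h; have [] := pP h; rewrite !mu_wordE => E1 E2 E3 E4.
- by rewrite -{2}E1; apply/eqv_sym/eqv_mu_word/eqP/(size_inv_eph n_ge3 e p h).
- by rewrite -{2}E3; apply/eqv_sym/eqv_mu_word/eqP/(size_inv_hep n_ge3 e p h).
- rewrite -{2}E2 -catA.
  exact/eqv_sym/eqv_mu_word/eqP/(size_inv_peh n_ge3 e p h).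
by rewrite -{2}E4; apply/eqv_sym/eqv_mu_word/eqP/(size_inv_hpe n_ge3 e p h).
Qed.

End PolyadicInverse.

(** * The binary group, the maps [phi_q] and the telescoping product *)

Section Invariance.

Variable (einv : G -> n.-2.-tuple G).
Hypothesis einvP : forall e, is_polyadic_inverse n_ge3 mu e (einv e).
Variable e : G.

Let p : seq G := einv e.
Let E (k : nat) : seq G := nseq k e.
Let P (k : nat) : seq G := flatten (nseq k p).

Let ED (j k : nat) : E j ++ E k = E (j + k).
Proof. by rewrite /E nseqD. Qed.

Let PD (j k : nat) : P j ++ P k = P (j + k).
Proof. by rewrite /P nseqD flatten_cat. Qed.

Let P1 : P 1 = p.
Proof. by rewrite /P /= cats0. Qed.

Let PE (k : nat) : eqv (P k ++ E k) [::].
Proof.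
elim: k => [|k IH]; first exact: eqv_refl.
rewrite -addn1 -PD P1 addn1 -[E k.+1]/([:: e] ++ E k) -catA (catA p).
by apply: eqv_trans IH; apply/eqv_cancel/(eqv_inverse (einvP e)).2.
Qed.

Let EP (k : nat) : eqv (E k ++ P k) [::].
Proof.
elim: k => [|k IH]; first exact: eqv_refl.
rewrite -addn1 -ED addn1 -[P k.+1]/(p ++ P k) -catA (catA (E 1)).
by apply: eqv_trans IH; apply/eqv_cancel/(eqv_inverse (einvP e)).1.
Qed.

Definition word_star (g h : G) : G := mu_word (g :: p ++ [:: h]).

Lemma word_starE (g h : G) (s t : seq G) :
  eqv [:: g] s -> eqv [:: h] t -> eqv [:: word_star g h] (s ++ p ++ t).
Proof.
move=> gs ht; apply: eqv_trans (eqv_cat gs (eqv_cat (eqv_refl p) ht)).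
by apply: eqv_mu_word; rewrite /= size_cat size_tuple /=; lia.
Qed.

Lemma word_star_is_group : is_group word_star e.
Proof.
have r := eqv_refl; split.
- move=> g h k; apply: eqv_inj.
  apply: (eqv_trans (word_starE (r _) (word_starE (r _) (r _)))).
  apply: eqv_sym.
  apply: (eqv_trans (word_starE (word_starE (r _) (r _)) (r _))).
  by rewrite -!catA.
- move=> g; apply: eqv_inj; apply: (eqv_trans (word_starE (r _) (r _))).
  by rewrite catA; apply: (eqv_cancel [::] _ (eqv_inverse (einvP e)).1).
- move=> g; apply: eqv_inj; apply: (eqv_trans (word_starE (r _) (r _))).
  by rewrite -{2}[[:: g]]cats0 -[p ++ _]cats0;
    apply: (eqv_cancel [:: g] [::] (eqv_inverse (einvP e)).2).
(* The [*]-inverse of [g] is [e g^-1 e], since [(e g^-1 e) e^-1 g = e = g e^-1 (e g^-1 e)]. *)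
move=> g; exists (mu_word (e :: einv g ++ [:: e])).
have hE : eqv [:: mu_word (e :: einv g ++ [:: e])] ([:: e] ++ einv g ++ [:: e]).
  by apply: eqv_mu_word; rewrite /= size_cat size_tuple /=; lia.
have [eP _] := eqv_inverse (einvP e); have [gP Pg] := eqv_inverse (einvP g).
have [_ Pe] := eqv_inverse (einvP e).
split; apply: eqv_inj.
  apply: (eqv_trans (word_starE hE (r [:: g]))); rewrite -!catA.
  apply: (eqv_trans (eqv_cancel ([:: e] ++ einv g) [:: g] eP)).
  by have := eqv_cancel [:: e] [::] Pg; rewrite !cats0.
apply: (eqv_trans (word_starE (r [:: g]) hE)).
rewrite (catA p); apply: (eqv_trans (eqv_cancel [:: g] _ Pe)).
exact: (eqv_cancel [::] [:: e] gP).
Qed.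

Lemma eqv_phi_q (q : nat) (adm : admissible n q) (k : nat) (g : G) :
  eqv [:: iter k (phi_q mu e (einv e) adm) g] (E k ++ [:: g] ++ P (k * q)).
Proof.
elim: k => [|k IH]; first exact: eqv_refl.
rewrite iterS; set x := iter k _ g in IH *.
apply: (@eqv_trans _ (E 1 ++ [:: x] ++ P q)).
  rewrite /phi_q iter_opE; apply: eqv_iter_word; apply/eqP.
  exact: (size_phi e (einv e) x adm).
apply: (eqv_trans (eqv_context (E 1) (P q) IH)).
by rewrite -!catA PD !catA ED add1n mulSn addnC.
Qed.

Lemma qnumS (q k : nat) : qnum q k.+1 = (1 + qnum q k * q)%N.
Proof.
rewrite /qnum big_ord_recl expn0 big_distrl /=; congr (_ + _).
by apply: eq_bigr => i _; rewrite -expnSr.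
Qed.

Lemma word_star_quasi (q : nat) (adm : admissible n q) :
  quasi_endomorphism word_star e (phi_q mu e (einv e) adm).
Proof.
have phiE x : eqv [:: phi_q mu e (einv e) adm x] ([:: e; x] ++ P q).
  by have := eqv_phi_q adm 1 x; rewrite mul1n.
have [eP Pe] := eqv_inverse (einvP e); have r := eqv_refl.
move=> g h; apply: eqv_inj.
(* Both sides reduce to [e g e^-q h e^-q]. *)
apply: (@eqv_trans _ ([:: e; g] ++ P q ++ h :: P q)).
  apply: (eqv_trans (word_starE (phiE g) (phiE h))).
  have := eqv_cancel ([:: e; g] ++ P q) (h :: P q) Pe.
  by rewrite -!catA.
apply: eqv_sym; apply: (eqv_trans (phiE _)).
have := word_starE (word_starE (r [:: g]) (phiE e)) (r [:: h]).
move/(eqv_context [:: e] (P q)) => /eqv_trans; apply.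
have := eqv_cancel [:: e; g] ([:: e] ++ P q ++ p ++ h :: P q) Pe.
rewrite -!catA => /eqv_trans; apply.
have := eqv_cancel [:: e; g] (P q ++ h :: P q) eP.
(* Powers of [p] commute, which brings a [p] next to the remaining [e]. *)
have pC : P q ++ p = p ++ P q by rewrite -P1 PD addnC -PD.
by rewrite (catA (P q) p) pC -(catA p).
Qed.

(** The starting index [k] is arbitrary so that the induction can pass to the tail of [s]. The final
    [e] is the value of the empty [*]-product. *)
Lemma eqv_big_phi_q (q : nat) (adm : admissible n q) (s : seq G) (k : nat) :
  eqv [:: \big[word_star/e]_(i < size s)
            iter (qnum q (k + i)) (phi_q mu e (einv e) adm) (nth x0 s i)]
      (E (qnum q k) ++ s ++ P (qnum q (k + size s)) ++ [:: e]).
Proof.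
elim: s k => [|x s IH] k.
  rewrite big_ord0 addn0 /= catA; apply: eqv_sym.
  exact: (eqv_cancel [::] [:: e] (EP _)).
rewrite big_ord_recl /= addn0 addnS -addSn.
have {}IH := IH k.+1; under eq_bigr do rewrite /bump /= add1n addnS -addSn.
apply: (eqv_trans (word_starE (eqv_phi_q adm (qnum q k) x) IH)).
(* The [p] contributed by [*] raises [q [[k]]] to [[[k+1]]], so this power cancels the [e^[[k+1]]]
   that opens the tail. *)
have PS : P (qnum q k * q) ++ p = P (qnum q k.+1).
  by rewrite -P1 PD addnC -qnumS.
rewrite -!catA (catA (P _) p) PS.
have := eqv_cancel (E (qnum q k) ++ [:: x])
  (s ++ P (qnum q (k.+1 + size s)) ++ [:: e]) (PE (qnum q k.+1)).
by rewrite -!catA.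
Qed.

Lemma M_qE (q : nat) (adm : admissible n q) (g : n.-tuple G) :
  M_q n_ge3 mu word_star e (einv e) adm g = mu g.
Proof.
have -> : mu g = mu_word g.
  by rewrite -(mu_wordE (valP g)); congr mu; apply: val_inj.
apply: eqv_inj; apply: eqv_trans (eqv_sym (eqv_mu_word (size_tuple g))).
have bE : eqv [:: b_q n_ge3 mu e adm] (E (qnum q n)).
  rewrite /b_q iter_opE; apply: eqv_iter_word; apply/eqP.
  exact: (size_b e n_ge3 adm).
have := eqv_big_phi_q adm g 0; rewrite size_tuple => bigE.
rewrite /M_q; under eq_bigr do rewrite (tnth_nth x0).
apply: (eqv_trans (word_starE bigE bE)).
(* The final [e] of the product cancels the [p] of the last [*]; then [e^-[[n]]] meets [b_q]. *)
rewrite /qnum big_ord0 /= -!catA (catA [:: e]).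
have [eP _] := eqv_inverse (einvP e).
have := eqv_cancel (g ++ P (qnum q n)) (E (qnum q n)) eP.
rewrite -!catA => /eqv_trans; apply.
by have := eqv_cancel g [::] (PE (qnum q n)); rewrite !cats0.
Qed.

End Invariance.
End PolyadCongruence.

Theorem theorem4p4 (n : nat) (n_ge3 : 3 <= n) (G : Type) (G_nonempty : inhabited G)
    (mu : nary_op n G) (mu_group : is_nary_group mu)
    (einv : G -> n.-2.-tuple G)
    (einvP : forall e : G, is_polyadic_inverse n_ge3 mu e (einv e)) :
  exists (star : G -> G -> G) (e : G),
    is_group star e /\
    forall (q : nat) (adm : admissible n q),
      quasi_endomorphism star e (phi_q mu e (einv e) adm) /\
      forall g : n.-tuple G, M_q n_ge3 mu star e (einv e) adm g = mu g.
Proof.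
case: G_nonempty mu_group => e [muA _].
(* Any element of [G] can serve as the identity; the chosen [e] is also the default letter [x0]. *)
exists (word_star mu e einv e), e; split; first exact: word_star_is_group.
move=> q adm; split; first exact: word_star_quasi.
exact: M_qE.
Qed.
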